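(* Let $\eta_\cdot$ be a two-state $d$-dimensional probabilistic cellular automaton of radius $r$, with transition probabilities $\{p(J): J\subset I_r\}$, that belongs to the class $\mathcal{C}$. If $p(I_r)<1$, then $\eta_\cdot$ is ergodic, and there exists a dual process $\xi_\cdot$, a discrete time Markov process whose state space is the set $\mathbf{Y}$ of all finite subsets of $\mathbb{Z}^d$, which satisfies $$\mathbb{E}_{\eta_0=x}[H(\eta_1,Y)]=\mathcal{D}(Y)\,\mathbb{E}_{\xi_0=Y}[H(x,\xi_1)]\qquad\text{for all } x\in\{0,1\}^{\mathbb{Z}^d},\ Y\in\mathbf{Y}.$$ Moreover, let $\mu$ be the unique invariant measure of $\eta_\cdot$. Then for any cylinder set $U\subset\{0,1\}^{\mathbb{Z}^d}$ there exist an index set $K$ with $|K|<\infty$, integers $(\alpha_k)_{k\in K}$ and finite subsets $(Y(k))_{k\in K}$ of $\mathbb{Z}^d$ such that $$\mu(U)=\sum_{k\in K}\alpha_k\left(\sum_{l=1}^{\infty}\mathbb{P}_{\xi_0=Y(k)}\{\xi_l=\emptyset\mid \xi_{l-1}\neq\emptyset\}\right).$$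
   Context: Let $d,r\ge 1$ be integers and $I_r=\{(i_1,\dots,i_d)\in\mathbb{Z}^d: -r\le i_1,\dots,i_d\le r\}$. A two-state $d$-dimensional probabilistic cellular automaton (PCA) of radius $r$ with transition probabilities $\{p(J):J\subset I_r\}\subset[0,1]$ is the discrete time Markov process $\eta_\cdot$ on $\{0,1\}^{\mathbb{Z}^d}$ such that, given $\eta_t=x$, the coordinates $\eta_{t+1}(z)$, $z\in\mathbb{Z}^d$, are independent and $\eta_{t+1}(z)=1$ with probability $p(J)$, where $J=\{j\in I_r: x(z+j)=1\}$. Class $\mathcal{C}$: a two-state PCA of radius $r$ belongs to $\mathcal{C}$ if there is a map $\lambda$ from the set $\wp(I_r)$ of all subsets of $I_r$ to $[0,1)$ such that $p(J)=\sum_{J'\subset J}\lambda(J')$ for all $J\subset I_r$ (the sum includes $J'=\emptyset$ and $J'=J$). Ergodic: the PCA has exactly one invariant probability measure $\mu$ and, from every initial distribution, the distribution of $\eta_t$ converges weakly to $\mu$ as $t\to\infty$. A cylinder set is a set $\{\zeta\in\{0,1\}^{\mathbb{Z}^d}:\zeta(x)=\phi(x)\ \forall x\in\Lambda\}$ with $\Lambda\subset\mathbb{Z}^d$ finite and $\phi\in\{0,1\}^{\mathbb{Z}^d}$. Duality functions: for $x\in\{0,1\}^{\mathbb{Z}^d}$ and $Y\in\mathbf{Y}$, $H(x,Y)=1$ if $x(z)=1$ for all $z\in Y$, and $H(x,Y)=0$ otherwise; $\mathcal{D}(Y)=p(I_r)^{|Y|}$, with $\mathcal{D}(\emptyset)=1$.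 Dual process: $\xi_\cdot$ evolves by $\xi_{t+1}=\bigcup_{z\in\xi_t}B(z)$, where the random sets $B(z)$ are independent and $B(z)=\{z+j: j\in J\}$ with probability $\pi(J)$ for each $J\subset I_r$ (in particular $B(z)=\emptyset$ with probability $\pi(\emptyset)$); here $\pi$ is a probability distribution on the subsets of $I_r$ with $\lambda(J)=p(I_r)\,\pi(J)$ for all $J\subset I_r$. The empty set is absorbing for $\xi_\cdot$.
   Formalization: The printed formula for μ(U) fails (e.g. d=r=1, λ(∅)=λ({0})=1/4); its summand is replaced by E_{Y(k)}[D(ξ_0)⋯D(ξ_{l-1}); ξ first equals ∅ at time l≥1], which is 1 at l=1 when Y(k)=∅. *)

(* Defs.v *)
From HB Require Import structures.
From mathcomp Require Import all_boot all_order all_algebra finmap.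
From mathcomp Require Import all_classical all_reals all_analysis.

Set Implicit Arguments.
Unset Strict Implicit.
Unset Printing Implicit Defensive.
Import Order.TTheory GRing.Theory Num.Theory.
Import numFieldNormedType.Exports.

Local Open Scope classical_set_scope.
Local Open Scope ring_scope.

Definition site (d : nat) := 'rV[int]_d.

(* I_r, encoded by the shift i |-> i + r of each coordinate to {0, ..., 2r};
   [disp] decodes. *)
Definition offset (d r : nat) := 'rV['I_(r.*2.+1)]_d.

Definition disp d r (j : offset d r) : site d :=
  \row_i ((j ord0 i)%:Z - r%:Z).

Definition Ir d r : {set offset d r} := [set: offset d r]%SET.

Definition cylinder_on d (L : {fset site d}) (phi : site d -> bool) :
    set (site d -> bool) :=
  [set zeta | forall z, z \in L -> zeta z = phi z].

Definition cylinders d : set (set (site d -> bool)) :=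
  [set U | exists L phi, U = cylinder_on L phi].

(* {0,1}^(Z^d) with the product sigma-algebra. *)
Notation config d := (g_sigma_algebraType (@cylinders d)).

(* Finite subsets of Z^d, with the discrete sigma-algebra. *)
Definition fsites (d : nat) := {fset site d}.
HB.instance Definition _ d := Choice.on (fsites d).
HB.instance Definition _ d := isPointed.Build (fsites d) fset0%fset.
HB.instance Definition _ d := @isMeasurable.Build default_measure_display
  (fsites d) discrete_measurable discrete_measurable0
  discrete_measurableC discrete_measurableU.

(* Time-homogeneous discrete time Markov processes are given by their
   transition kernels; [law k nu t] is the distribution at time t of the
   process with initial distribution nu. *)
Section markov.
Context {R : realType} {dT : measure_display} {T : measurableType dT}.
Variable k : R.-pker T ~> T.
Local Open Scope ereal_scope.

Definition next_law (nu : probability T R) (A : set T) : \bar R :=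
  \int[nu]_x k x A.

Section next_law_probability.
Variable nu : probability T R.

Let next_law0 : next_law nu set0 = 0.
Proof. by rewrite /next_law; apply: integral0_eq => x _; rewrite measure0. Qed.

Let next_law_ge0 A : 0 <= next_law nu A.
Proof. exact: integral_ge0. Qed.

Let next_law_sigma_additive : semi_sigma_additive (next_law nu).
Proof.
move=> F mF tF mUF; rewrite [X in _ --> X](_ : _ =
    \int[nu]_x (\sum_(n <oo) k x (F n))); last first.
  by apply: eq_integral => x _; exact: measure_semi_bigcup.
rewrite integral_nneseries//; last by move=> n; exact: measurable_kernel.
by apply: is_cvg_nneseries => n _ _; exact: integral_ge0.
Qed.

HB.instance Definition _ := isMeasure.Build _ _ _ (next_law nu)
  next_law0 next_law_ge0 next_law_sigma_additive.

Let next_law_setT : next_law nu [set: T] = 1.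
Proof.
rewrite /next_law (eq_integral (cst 1)); last first.
  by move=> x _; rewrite prob_kernel.
by rewrite integral_cst//= mul1e probability_setT.
Qed.

HB.instance Definition _ := Measure_isProbability.Build _ _ _ (next_law nu)
  next_law_setT.

End next_law_probability.

Definition law (nu : probability T R) (t : nat) : probability T R :=
  iter t (fun m : probability T R => next_law m : probability T R) nu.

Definition invariant_law (mu : probability T R) : Prop :=
  forall A, measurable A -> next_law mu A = mu A.

End markov.

Section ergodicity.
Context {R : realType} {d : nat}.
Local Open Scope ereal_scope.

(* Continuity is for the product topology of the discrete two-point spaces. *)
Definition weak_cvg (nu_ : nat -> probability (config d) R)
    (mu : probability (config d) R) : Prop :=
  forall f : {ptws site d -> bool} -> R,
    continuous f -> (exists M : R, forall x, (`|f x| <= M)%R) ->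
    \int[nu_ t]_x (f x)%:E @[t --> \oo] --> \int[mu]_x (f x)%:E.

(* Uniqueness is up to equality on measurable sets, because measures are
   functions on all sets. *)
Definition ergodic (k : R.-pker config d ~> config d) : Prop :=
  exists mu : probability (config d) R,
    [/\ invariant_law k mu,
        forall nu : probability (config d) R, invariant_law k nu ->
          forall A, measurable A -> nu A = mu A
      & forall nu : probability (config d) R, weak_cvg (law k nu) mu].

End ergodicity.

Section pca.
Context {R : realType} {d r : nat}.
Variable p : {set offset d r} -> R.

Definition neighbours (x : site d -> bool) (z : site d) : {set offset d r} :=
  [set j | x (z + disp j)]%SET.

(* Given x, the new coordinates are independent Bernoulli variables: the
   product formula on cylinders determines the law k x. *)
Definition is_PCA (k : R.-pker config d ~> config d) : Prop :=
  forall (x : config d) (L : {fset site d}) (phi : site d -> bool),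
    k x (cylinder_on L phi) =
    (\prod_(z <- L) (if phi z then p (neighbours x z)
                     else 1 - p (neighbours x z)))%:E.

Definition class_C_map (lam : {set offset d r} -> R) : Prop :=
  (forall J, 0 <= lam J < 1) /\
  (forall J : {set offset d r},
     p J = \sum_(J' : {set offset d r} | J' \subset J) lam J').

Definition class_C : Prop := exists lam, class_C_map lam.

Definition dualH (x : site d -> bool) (Y : fsites d) : R :=
  [forall z : Y, x (val z)]%:R.

Definition dualD (Y : fsites d) : R := p (Ir d r) ^+ #|` Y|.

End pca.

Section dual.
Context {R : realType} {d r : nat}.
Local Open Scope ereal_scope.

Definition is_distribution (pi : {set offset d r} -> R) : Prop :=
  (forall J, (0 <= pi J)%R) /\ (\sum_J pi J = 1)%R.

Definition branch (Y : fsites d) (b : {ffun Y -> {set offset d r}}) :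
    fsites d :=
  (\big[fsetU/fset0]_(z : Y) [fset (val z + disp j)%R | j in b z])%fset.

(* Each z in Y independently chooses b z with law pi and is replaced by
   z + b z. *)
Definition is_dual_process (pi : {set offset d r} -> R)
    (xi : R.-pker fsites d ~> fsites d) : Prop :=
  forall (Y : fsites d) (A : set (fsites d)),
    xi Y A = \sum_(b : {ffun Y -> {set offset d r}})
               (\prod_(z : Y) pi (b z))%:E * \d_(branch b) A.

(* By the Markov property at time 1, this is
     E_Y [ D(xi_0) ... D(xi_(l-1)) ; xi_m <> set0 for 0 < m < l, xi_l = set0 ],
   that is, the probability that the chain started at Y and killed at each
   step with probability 1 - D(current state) first visits the empty set, at
   a time l >= 1, exactly at time l. Iterating the duality relation produces
   these weights. Starting from the empty set, the value is 1 for l = 1 and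
   0 for l > 1. *)
Fixpoint absorption (D : fsites d -> R) (xi : R.-pker fsites d ~> fsites d)
    (l : nat) (Y : fsites d) : \bar R :=
  match l with
  | 0%N => 0
  | 1%N => (D Y)%:E * xi Y [set fset0%fset]
  | l'.+1 => (D Y)%:E *
      \int[xi Y]_(Y' in ~` [set fset0%fset]) absorption D xi l' Y'
  end.

End dual.

(* Main.v *)
(* Write F_P(Y) for the probability under P of a 1 at every site of Y.
   The duality relation says that one step of the automaton sends F_P to T F_P,
   where T g (Y) = D(Y) E_Y[g(xi_1)]. Since T multiplies by at most p(I_r) < 1 on
   nonempty Y, and F_P(set0) = 1, iterating T from any P gives the probability
   that the dual killed with the weights D is absorbed within t steps, up to an
   error at most p(I_r)^t. So F converges to the absorption series h, uniformly
   in P.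

   Inclusion-exclusion writes the probability of a cylinder as an integer
   combination of values of F, so all cylinder probabilities converge, to limits
   independent of P. The limits are consistent and define mu, constructed as the
   law under Lebesgue measure on [0, 1[ of a configuration read off from nested
   dyadic-like intervals with prescribed lengths. The identity T h = h gives the
   invariance of mu, and F_P = h for invariant P gives uniqueness. Weak convergence
   follows because a continuous function on the compact space {0,1}^(Z^d) is a
   uniform limit of functions of finitely many coordinates. *)
Require Import Defs.
From HB Require Import structures.
From mathcomp Require Import all_boot all_order all_algebra finmap.
From mathcomp Require Import all_classical all_reals all_analysis.
From mathcomp Require Import measurable_realfun.
From mathcomp Require Import ring.
Import Order.TTheory GRing.Theory Num.Theory.
Import numFieldNormedType.Exports.
Set Implicit Arguments.
Unset Strict Implicit.
Unset Printing Implicit Defensive.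
Local Open Scope classical_set_scope.
Local Open Scope ring_scope.

(** * Finite-dimensional events *)

Section constraints.
Context {R : realType} {d : nat}.
Implicit Types (s : seq (site d * bool)) (Y : {fset site d}).

(** Constraints at one site may contradict each other, so these events are closed under
    intersection; two incompatible cylinders meet in the empty set, which is no cylinder. *)
Definition constrained s : set (config d) :=
  [set x | all (fun c => x c.1 == c.2) s].

Definition ones (Y : fsites d) : set (config d) := cylinder_on Y (fun=> true).

Lemma measurable_cylinder_on (L : {fset site d}) phi :
  measurable (cylinder_on L phi : set (config d)).
Proof. by apply: sub_sigma_algebra; exists L, phi. Qed.

Lemma cylinder_onE (L : {fset site d}) phi :
  cylinder_on L phi = constrained [seq (z, phi z) | z <- L].
Proof.
apply/seteqP; split => x /=.
- by move=> Lx; rewrite /constrained/= all_map; apply/allP => z zL /=;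
  rewrite Lx.
- by rewrite /constrained/= all_map => /allP Lx z zL; exact/eqP/Lx.
Qed.

Lemma constrained_cons z b s : constrained ((z, b) :: s) =
  [set x | x z = b] `&` constrained s.
Proof.
apply/seteqP; split => x; rewrite /constrained /=.
- by move=> /andP[/eqP].
- by case=> -> ->; rewrite eqxx.
Qed.

Lemma constrained_cat s1 s2 :
  constrained (s1 ++ s2) = constrained s1 `&` constrained s2.
Proof.
apply/seteqP; split => x; rewrite /constrained /= all_cat.
  by move=> /andP[].
by case=> -> ->.
Qed.

Lemma measurable_coord z b : measurable ([set x | x z = b] : set (config d)).
Proof.
rewrite (_ : [set x | _] = cylinder_on [fset z]%fset (fun=> b)).
  exact: measurable_cylinder_on.
apply/seteqP; split => x /=; first by move=> xzb y; rewrite inE => /eqP ->.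
by move=> /(_ z) -> //; rewrite inE.
Qed.

Lemma measurable_constrained s : measurable (constrained s).
Proof.
elim: s => [|[z b] s IH].
  by rewrite (_ : constrained _ = setT)//; apply/seteqP; split.
by rewrite constrained_cons; apply: measurableI => //; exact: measurable_coord.
Qed.

End constraints.

Section probability_of_measure.
Context {disp} {T : measurableType disp} {R : realType}.
Variable M : {measure set T -> \bar R}.
Hypothesis M1 : M setT = 1%E.

Definition probability_of_measure of M setT = 1%E : set T -> \bar R := M.

HB.instance Definition _ := Measure.on (probability_of_measure M1).
HB.instance Definition _ :=
  Measure_isProbability.Build _ _ _ (probability_of_measure M1) M1.

End probability_of_measure.

(** * Measures with prescribed cylinder probabilities *)

(* Words list the letters in reverse order, the most recent first. The interval
   of [w] has left endpoint [left_end w] and length [m w]; that of [false :: w] is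
   its left part and that of [true :: w] its right part. *)
Section splitting.
Context {R : realType} {d : nat}.
Variables (e : nat -> site d) (e' : site d -> nat).
Hypothesis eK : cancel e e'.
Variable m : seq bool -> R.
Hypothesis m_ge0 : forall w, 0 <= m w.
Hypothesis m_nil : m [::] = 1.
Hypothesis m_split : forall w, m w = m (false :: w) + m (true :: w).

Fixpoint left_end (w : seq bool) : R :=
  if w is b :: w' then left_end w' + (if b then m (false :: w') else 0) else 0.

Definition next_bit (u : R) (w : seq bool) : bool :=
  left_end w + m (false :: w) <= u.

Fixpoint word (u : R) (n : nat) : seq bool :=
  if n is n'.+1 then next_bit u (word u n') :: word u n' else [::].

(** By [m_split] the intervals of [false :: w] and [true :: w] partition that of [w] at the
    threshold of [next_bit]. A point outside the interval of [w] lies in neither half. *)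
Lemma word_itv u w : 0 <= u < 1 ->
  (word u (size w) == w) = (left_end w <= u < left_end w + m w).
Proof.
move=> u01; elim: w => [|b w IH] /=; first by rewrite eqxx add0r m_nil u01.
rewrite eqseq_cons; have [eqw|neqw] := eqVneq (word u (size w)) w.
  move: IH; rewrite eqw eqxx andbT /next_bit => /esym /andP[h1 h2].
  case: b; rewrite ?addr0 ?h1 /= ?eqb_id.
    by rewrite -addrA -m_split h2 andbT.
  by rewrite eqbF_neg -ltNge.
rewrite andbF; apply/esym/negbTE/negP => /andP[h1 h2].
move/negbTE: neqw; rewrite IH => /negP; apply; case: b h1 h2.
  rewrite -addrA -m_split => h1 ->; rewrite andbT.
  by apply: le_trans h1; rewrite lerDl.
rewrite addr0 => -> h2; apply: lt_le_trans h2 _.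
by rewrite lerD2l [leRHS]m_split lerDl.
Qed.

Lemma left_end01 w : 0 <= left_end w /\ left_end w + m w <= 1.
Proof.
elim: w => [|b w [h0 h1]] /=; first by rewrite m_nil add0r.
split; first by rewrite addr_ge0//; case: b.
rewrite (le_trans _ h1)// -addrA lerD2l (m_split w).
by case: b => //; rewrite add0r lerDl.
Qed.

Definition bits (u : R) : config d := fun z => next_bit u (word u (e' z)).

Fixpoint prefix_word (x : site d -> bool) (n : nat) : seq bool :=
  if n is n'.+1 then x (e n') :: prefix_word x n' else [::].

Lemma prefix_word_bits u n : prefix_word (bits u) n = word u n.
Proof. by elim: n => //= n ->; rewrite /bits eK. Qed.

Lemma measurable_word n w : measurable [set u | word u n = w].
Proof.
elim: n w => [|n IH] [|b w].
- by rewrite (_ : [set u | _] = setT)//; apply/seteqP; split.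
- by rewrite (_ : [set u | _] = set0)//; apply/seteqP; split.
- by rewrite (_ : [set u | _] = set0)//; apply/seteqP; split.
rewrite (_ : [set u | _] =
   [set u | (left_end w + m (false :: w) <= u) = b] `&` [set u | word u n = w]).
  apply: measurableI => //; case: b.
    rewrite (_ : [set u | _] = `[left_end w + m (false :: w), +oo[%classic)//.
    by apply/seteqP; split => u /=; rewrite in_itv/= andbT.
  rewrite (_ : [set u | _] = `]-oo, left_end w + m (false :: w)[%classic)//.
  by apply/seteqP; split => u /=; rewrite in_itv/= ltNge;
    [move=> ->|move=> /negbTE].
apply/seteqP; split => u /=; first by case=> <- <-.
by case=> <- <-.
Qed.

Lemma measurable_bits : measurable_fun setT bits.
Proof.
apply: (@measurability _ _ _ (config d) setT bits (@cylinders d) erefl).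
move=> _ [_ [L [phi ->]] <-]; rewrite setTI.
rewrite (_ : _ @^-1` _ =
    \bigcap_(z in [set` L]) [set u | next_bit u (word u (e' z)) = phi z]);
  last first.
  by apply/seteqP; split.
apply: fin_bigcap_measurable => // z _.
(* The bit at [z] depends on [u] through its word of length [e' z], which takes countably many
   values. *)
rewrite (_ : [set u | _] =
    \bigcup_w [set u | word u (e' z).+1 = phi z :: w]).
  apply: countable_bigcupT_measurable => [|w]; first exact: countableP.
  exact: measurable_word.
apply/seteqP; split => u /=.
  by move=> <-; exists (word u (e' z)).
by case=> w _ [].
Qed.

(** Under [bits], a prefix event pulls back to the interval of its word, whose Lebesgue measure is
    [m w]. *)
Lemma bits_law_exists : exists P : probability (config d) R,
  forall w, P [set x | prefix_word x (size w) = w] = (m w)%:E.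
Proof.
pose leb01 := mrestr (@lebesgue_measure R) (measurable_itv `[0, 1[).
pose pushforward_bits : {measure set (config d) -> \bar R} :=
  pushforward leb01 bits.
pose M := pushforward_bits measurable_bits.
have M1 : M setT = 1%E.
  by rewrite /M/= /pushforward_bits/= /pushforward preimage_setT /leb01 /mrestr
    setTI lebesgue_measure_itv/= lte01 oppr0 adde0.
exists (probability_of_measure M1) => w.
rewrite /probability_of_measure /M /pushforward_bits/= /pushforward.
rewrite /leb01 /mrestr.
rewrite (_ : _ `&` _ = `[left_end w, left_end w + m w[%classic).
  rewrite lebesgue_measure_itv/= lte_fin ltrDl.
  (* When [m w] vanishes the interval is empty and has measure 0 = [m w]. *)
  case: ltP => [_|w0]; first by rewrite -EFinB addrAC subrr add0r.
  by congr EFin; apply/eqP; rewrite eq_le m_ge0.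
apply/seteqP; split => u /=; rewrite prefix_word_bits !in_itv/=.
  by move=> [/eqP + u01]; rewrite word_itv.
move=> wu; have [w0 w1] := left_end01 w.
have u01 : 0 <= u < 1.
  case/andP: wu => wu uw; rewrite (le_trans w0 wu)/=.
  exact: lt_le_trans uw w1.
by split => //; apply/eqP; rewrite word_itv.
Qed.
End splitting.


(** * Inclusion-exclusion, and laws determined by their all-ones events *)

Section expansion.
Context {R : realType} {d : nat}.
Implicit Types (P Q : probability (config d) R) (Y : fsites d)
  (s : seq (site d * bool)).

Definition all_ones P Y : R := fine (P (ones Y)).

Lemma all_onesE P Y : P (ones Y) = (all_ones P Y)%:E.
Proof.
by rewrite /all_ones fineK// fin_num_measure//; exact: measurable_cylinder_on.
Qed.

Lemma onesU1 z Y : ones (z |` Y)%fset = ones Y `&` [set x | x z = true].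
Proof.
apply/seteqP; split => x /=.
  move=> xY; split; last by apply: xY; rewrite !inE eqxx.
  by move=> y yY; apply: xY; rewrite !inE yY orbT.
move=> [xY xz] y; rewrite !inE => /orP[/eqP -> //|]; exact: xY.
Qed.

Lemma ones0 : ones (fset0 : fsites d) = setT.
Proof. by apply/seteqP; split. Qed.

(* Inclusion-exclusion over the sites constrained to be 0. *)
Lemma constrained_expansion s Y :
  exists (K : finType) (alpha : K -> int) (Z : K -> fsites d), forall P,
    P (ones Y `&` constrained s) =
    (\sum_k (alpha k)%:~R * all_ones P (Z k))%:E.
Proof.
elim: s Y => [|[z [] ] s IH] Y.
- exists 'I_1, (fun=> 1%Z), (fun=> Y) => P.
  rewrite big_ord1 mulr1z mul1r -all_onesE; congr (P _).
  by rewrite (_ : constrained _ = setT) ?setIT//; apply/seteqP; split.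
- have [K [alpha [Z KE]]] := IH (z |` Y)%fset.
  exists K, alpha, Z => P; rewrite -KE; congr (P _).
  by rewrite constrained_cons onesU1 setIA.
have [K1 [alpha1 [Z1 KE1]]] := IH Y.
have [K2 [alpha2 [Z2 KE2]]] := IH (z |` Y)%fset.
exists (K1 + K2)%type,
  (fun k => match k with inl i => alpha1 i | inr j => - alpha2 j end),
  (fun k => match k with inl i => Z1 i | inr j => Z2 j end) => P.
rewrite big_sumType/= EFinD -KE1.
have -> : (\sum_i (- alpha2 i)%:~R * all_ones P (Z2 i) =
    - \sum_i (alpha2 i)%:~R * all_ones P (Z2 i)).
  by rewrite -sumrN; apply: eq_bigr => i _; rewrite mulrNz mulNr.
rewrite EFinN -KE2.
have mA : measurable (ones Y `&` constrained s).
  apply: measurableI;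
    [exact: measurable_cylinder_on|exact: measurable_constrained].
have mz : measurable ([set x | x z = true] : set (config d)).
  exact: measurable_coord.
rewrite (_ : ones (z |` Y)%fset `&` _ =
  (ones Y `&` constrained s) `&` [set x | x z = true]); last first.
  by rewrite onesU1 setIAC.
rewrite -measureD//; last by rewrite ltey_eq fin_num_measure.
congr (P _); rewrite constrained_cons setDE setIA setIAC; congr (_ `&` _).
by apply/seteqP; split => x /=; case: (x z).
Qed.

(** The constrained events are a pi-system generating the product sigma-algebra, and
    inclusion-exclusion computes their probabilities from [all_ones]. *)
Lemma eq_probability P Q : all_ones P =1 all_ones Q ->
  forall A, measurable A -> P A = Q A.
Proof.
move=> PQ A mA.
have H : @setI_closed (config d) (range (@constrained d)).
  move=> _ _ [s _ <-] [s' _ <-].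
  by exists (s ++ s'); rewrite // constrained_cat.
apply: (@g_sigma_algebra_measure_unique _ _ _ (range (@constrained d)) _
  (fun=> setT)) => //.
- by move=> _ [s _ <-]; exact: measurable_constrained.
- by move=> _; exists [::] => //; apply/seteqP; split.
- by rewrite bigcup_const.
- move=> _ [s _ <-]; have [K [alpha [Z KE]]] := constrained_expansion s fset0.
  move: (KE P) (KE Q); rewrite ones0 setTI => PE QE.
  apply: (etrans PE); apply/esym/(etrans QE); congr EFin.
  by apply: eq_bigr => k _; rewrite PQ.
- move=> _; apply: (le_lt_trans (probability_le1 P _) (ltry _)).
  exact: measurableT.
apply: sub_sigma_algebra2 mA => _ [L [phi ->]].
by exists [seq (z, phi z) | z <- L] => //; rewrite -cylinder_onE.
Qed.

End expansion.


(** * The dual process *)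

Section dual_kernel.
Context {R : realType} {d r : nat}.
Variable pi : {set offset d r} -> R.
Hypothesis pi_distr : is_distribution pi.

Definition dual_weight (Y : fsites d) (b : {ffun Y -> {set offset d r}}) : R :=
  \prod_(z : Y) pi (b z).

Lemma dual_weight_ge0 (Y : fsites d) (b : {ffun Y -> {set offset d r}}) :
  0 <= dual_weight b.
Proof. by apply: prodr_ge0 => z _; case: pi_distr. Qed.

(** Summing over choice functions factorizes into a product, over [Y], of the total mass of [pi]. *)
Lemma sum_dual_weight (Y : fsites d) :
  \sum_(b : {ffun Y -> {set offset d r}}) dual_weight b = 1.
Proof.
rewrite /dual_weight -(bigA_distr_bigA (fun (z : Y) J => pi J)).
by rewrite big1// => z _; case: pi_distr.
Qed.

(* [branch b] for [b] drawn from [dual_weight], written as a sum of measures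
   indexed by nat because [msum] requires it. *)
Definition dual_step (Y : fsites d) : {measure set (fsites d) -> \bar R} :=
  let b0 : {ffun Y -> {set offset d r}} := [ffun=> finset.set0] in
  let b k := nth b0 (enum {ffun Y -> {set offset d r}}) k in
  msum (fun k => mscale (NngNum (dual_weight_ge0 (b k))) \d_(branch (b k)))
    #|{ffun Y -> {set offset d r}}|.

Lemma sum_enum_ffun (Y : fsites d) (V : nmodType)
    (F : {ffun Y -> {set offset d r}} -> V) b0 :
  \sum_(k < #|{ffun Y -> {set offset d r}}|)
    F (nth b0 (enum {ffun Y -> {set offset d r}}) k) = \sum_b F b.
Proof.
rewrite -[RHS]big_enum (big_nth b0) -cardE big_mkord.
by apply: eq_bigl => b.
Qed.

Local Open Scope ereal_scope.

Lemma dual_stepE (Y : fsites d) (A : set (fsites d)) : dual_step Y A =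
  \sum_(b : {ffun Y -> {set offset d r}}) (dual_weight b)%:E * \d_(branch b) A.
Proof. by rewrite -(sum_enum_ffun _ [ffun=> finset.set0]). Qed.

Lemma integral_dual_step (Y : fsites d) (A : set (fsites d))
    (f : fsites d -> \bar R) : (forall y, A y -> 0 <= f y) ->
  \int[dual_step Y]_(y in A) f y =
  \sum_(b : {ffun Y -> {set offset d r}})
    (dual_weight b)%:E * (\d_(branch b) A * f (branch b)).
Proof.
move=> f0.
rewrite ge0_integral_measure_sum// -(sum_enum_ffun _ [ffun=> finset.set0]).
by apply: eq_bigr => k _; rewrite ge0_integral_mscale// integral_dirac.
Qed.

Let measurable_dual_step (A : set (fsites d)) : measurable A ->
  measurable_fun setT (fun Y => dual_step Y A).
Proof. by []. Qed.

HB.instance Definition _ := isKernel.Build _ _ _ _ R dual_step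
  measurable_dual_step.

Let dual_step_prob Y : dual_step Y setT = 1.
Proof.
rewrite dual_stepE; under eq_bigr do rewrite diracT mule1.
by rewrite sumEFin sum_dual_weight.
Qed.

HB.instance Definition _ := Kernel_isProbability.Build _ _ _ _ R dual_step
  dual_step_prob.

End dual_kernel.


(** * The one-step duality relation *)

Lemma prodr_bool (R : realType) (I : finType) (P : pred I) :
  \prod_(i : I) (P i)%:R = [forall i, P i]%:R :> R.
Proof.
have [/forallP allP|/forallPn[i Pi]] := boolP [forall i, P i].
  by rewrite big1// => i _; rewrite allP.
by rewrite (bigD1 i)//= (negbTE Pi) mul0r.
Qed.

Section duality.
Context {R : realType} {d r : nat}.
Variables (p lam pi : {set offset d r} -> R).
Hypothesis p_lam : class_C_map p lam.
Hypothesis pi_distr : is_distribution pi.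
Hypothesis lam_pi : forall J, lam J = p (Ir d r) * pi J.

Lemma dualH_branch (x : site d -> bool) (Y : fsites d)
    (b : {ffun Y -> {set offset d r}}) :
  dualH x (branch b) = [forall z : Y, b z \subset neighbours x (val z)]%:R :> R.
Proof.
congr (_%:R); congr (nat_of_bool _); apply/forallP/forallP => [xb z|xb [y yb]].
  apply/fintype.subsetP => j jb; rewrite inE.
  have zj : val z + disp j \in branch b.
    apply/bigfcupP; exists z; first by rewrite mem_index_enum.
    by apply/imfsetP; exists j.
  exact: (xb [` zj]%fset).
move: (yb) => /bigfcupP[z _ /imfsetP[j /= jb ->]].
by have /fintype.subsetP/(_ j jb) := xb z; rewrite inE.
Qed.

(** Class C gives p(N) = p(I_r) times the sum of pi(J) over J contained in N. Expanding the product
    of these sums over [Y] selects one J per site, that is, a branching [b]; all the selected J fit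
    exactly when [x] is 1 on [branch b]. *)
Lemma pca_dual_prod (x : site d -> bool) (Y : fsites d) :
  \prod_(z <- Y) p (neighbours x z) = dualD p Y *
  \sum_(b : {ffun Y -> {set offset d r}}) dual_weight pi b * dualH x (branch b).
Proof.
transitivity (\prod_(z : Y) (p (Ir d r) *
    \sum_(J : {set offset d r}) pi J * (J \subset neighbours x (val z))%:R)).
  rewrite big_seq_fsetE /=; apply: eq_bigr => z _.
  case: p_lam => _ ->; rewrite mulr_sumr big_mkcond/=.
  apply: eq_bigr => J _; rewrite lam_pi.
  by case: (J \subset _); rewrite ?mulr1// !mulr0.
rewrite big_split/= prodr_const /dualD cardfE; congr (_ * _).
rewrite (bigA_distr_bigA (fun (z : Y) J =>
  pi J * (J \subset neighbours x (val z))%:R)).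
by apply: eq_bigr => b _; rewrite big_split/= prodr_bool dualH_branch.
Qed.

Lemma dualH_ones (x : site d -> bool) (Y : fsites d) :
  dualH x Y = \1_(ones Y) x :> R.
Proof.
rewrite /dualH indicE; congr (_%:R); congr (nat_of_bool _).
apply/forallP/idP => [xY|/set_mem xY [z zY]]; last exact: xY.
by apply/mem_set => z zY; exact: (xY [` zY]%fset).
Qed.

Lemma dualH_ge0 (x : site d -> bool) (Y : fsites d) : 0 <= dualH x Y :> R.
Proof. by rewrite /dualH ler0n. Qed.

Lemma integral_dualH (P : {measure set (config d) -> \bar R}) (Y : fsites d) :
  (\int[P]_x (dualH x Y)%:E = P (ones Y))%E.
Proof.
under eq_integral do rewrite dualH_ones.
by rewrite integral_indic ?setIT//; exact: measurable_cylinder_on.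
Qed.

Section one_step.
Variable k : R.-pker config d ~> config d.
Hypothesis k_pca : is_PCA p k.

Lemma pca_ones (x : config d) (Y : fsites d) :
  k x (ones Y) = (dualD p Y *
  \sum_(b : {ffun Y -> {set offset d r}})
    dual_weight pi b * dualH x (branch b))%:E.
Proof. by rewrite k_pca -pca_dual_prod. Qed.

Lemma dualD_ge0 (p_ge0 : 0 <= p (Ir d r)) (Y : fsites d) : 0 <= dualD p Y.
Proof. exact: exprn_ge0. Qed.

(** This is duality integrated over the starting configuration: the mean of [dualH x Z] under [P] is
    [all_ones P Z]. *)
Lemma all_ones_next_law (p_ge0 : 0 <= p (Ir d r))
    (P : probability (config d) R) (Y : fsites d) :
  all_ones (next_law k P) Y = dualD p Y *
  \sum_(b : {ffun Y -> {set offset d r}})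
    dual_weight pi b * all_ones P (branch b).
Proof.
apply: EFin_inj; rewrite -all_onesE.
change (\int[P]_x k x (ones Y) = (dualD p Y *
  \sum_(b : {ffun Y -> {set offset d r}})
    dual_weight pi b * all_ones P (branch b))%:E)%E.
under eq_integral do rewrite pca_ones EFinM.
have mH Y' : measurable_fun setT (fun x : config d => (dualH x Y')%:E : \bar R).
  apply/measurable_EFinP.
  rewrite (_ : (fun _ => _) = \1_(ones Y' : set (config d))).
    by apply: measurable_indic; exact: measurable_cylinder_on.
  by apply/funext => x; rewrite dualH_ones.
have mwH (b : {ffun Y -> {set offset d r}}) : measurable_fun setT
    (fun x : config d => (dual_weight pi b * dualH x (branch b))%:E : \bar R).
  exact: (measurable_funeM (dual_weight pi b)%:E (mH (branch b))).
have w0 := dual_weight_ge0 pi_distr.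
have H0 (x : config d) Y' : (0 <= (dualH x Y' : R)%:E)%E.
  by rewrite lee_fin dualH_ge0.
under eq_integral do rewrite -sumEFin.
rewrite ge0_integralZl//; last 3 first.
- by apply: emeasurable_sum => b; exact: mwH.
- by move=> x _; apply: sume_ge0 => b _; rewrite lee_fin mulr_ge0// dualH_ge0.
- by rewrite lee_fin dualD_ge0.
rewrite EFinM ge0_integral_sum//; last first.
- by move=> b x _; rewrite lee_fin mulr_ge0// dualH_ge0.
rewrite -sumEFin; congr (_ * _)%E; apply: eq_bigr => b _.
under eq_integral do rewrite EFinM.
by rewrite ge0_integralZl ?lee_fin// integral_dualH EFinM -all_onesE.
Qed.

Lemma pca_duality (x : config d) (Y : fsites d) :
  (\int[k x]_y (dualH y Y : R)%:E =
   (dualD p Y)%:E * \int[dual_step pi_distr Y]_Y' (dualH x Y' : R)%:E)%E.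
Proof.
rewrite (integral_dualH (k x)) pca_ones EFinM.
rewrite integral_dual_step; last by move=> y _; rewrite lee_fin dualH_ge0.
rewrite -sumEFin; congr (_ * _)%E; apply: eq_bigr => b _.
by rewrite EFinM diracT mul1e.
Qed.

End one_step.
End duality.


(** * Convergence to the absorption series *)

Section absorption_series.
Context {R : realType} {d r : nat}.
Variables (p pi : {set offset d r} -> R).
Hypothesis pi_distr : is_distribution pi.
Hypothesis p_ge0 : 0 <= p (Ir d r).
Hypothesis p_lt1 : p (Ir d r) < 1.

Let D : fsites d -> R := dualD p.

(** The operator T, as a finite real sum, which commutes with pointwise limits. *)
Definition averaged (g : fsites d -> R) (Y : fsites d) : R :=
  D Y * \sum_(b : {ffun Y -> {set offset d r}}) dual_weight pi b * g (branch b).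

(** Real form of [absorption]: the integration domain of nonempty sets becomes an indicator
    factor. *)
Definition absorption_real (l : nat) : fsites d -> R :=
  if l is l'.+1 then
    iter l' (fun g => averaged (fun Y => (Y != fset0)%:R * g Y))
      (averaged (fun Y => (Y == fset0)%:R))
  else fun=> 0.

Lemma averaged_ge0 g : (forall Y, 0 <= g Y) -> forall Y, 0 <= averaged g Y.
Proof.
move=> g0 Y; rewrite mulr_ge0 ?dualD_ge0//; apply: sumr_ge0 => b _.
by rewrite mulr_ge0// dual_weight_ge0.
Qed.

Lemma averagedD g h Y :
  averaged (fun Y => g Y + h Y) Y = averaged g Y + averaged h Y.
Proof.
rewrite -mulrDr -big_split/=; congr (_ * _).
by apply: eq_bigr => b _; rewrite mulrDr.
Qed.

Lemma averagedB g h Y :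
  averaged (fun Y => g Y - h Y) Y = averaged g Y - averaged h Y.
Proof.
rewrite -mulrBr -sumrB; congr (_ * _).
by apply: eq_bigr => b _; rewrite mulrBr.
Qed.

Lemma eq_averaged g h : g =1 h -> averaged g =1 averaged h.
Proof. by move=> gh; have -> : g = h by exact/funext. Qed.

Lemma averaged_fset0 g : averaged g fset0 = g fset0.
Proof.
rewrite /averaged /D /dualD cardfs0 expr0 mul1r.
rewrite (eq_bigr (fun b => dual_weight pi b * g fset0)).
  by rewrite -mulr_suml sum_dual_weight// mul1r.
move=> b _; congr (_ * g _); rewrite /branch big1// => z _.
by case: z => z zY; exfalso; rewrite in_fset0 in zY.
Qed.

Lemma absorption_real_ge0 l Y : 0 <= absorption_real l Y.
Proof.
case: l => [|l]; first exact: lexx.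
elim: l Y => [|l IH] Y /=.
  by apply: averaged_ge0 => Y'.
by apply: averaged_ge0 => Z; apply: mulr_ge0 => //; exact: IH.
Qed.

Lemma absorptionE l Y :
  absorption D (dual_step pi_distr) l Y = (absorption_real l Y)%:E.
Proof.
case: l => [//|l]; elim: l Y => [|l IH] Y.
  rewrite /= dual_stepE /averaged EFinM -sumEFin; congr (_ * _)%E.
  apply: eq_bigr => b _; rewrite EFinM diracE; congr (_ * (_%:R)%:E)%E.
  congr nat_of_bool; apply/idP/eqP => [/set_mem//|bE]; exact/mem_set.
transitivity ((D Y)%:E * \int[dual_step pi_distr Y]_(Y' in ~` [set fset0])
    absorption D (dual_step pi_distr) l.+1 Y')%E; first by [].
under eq_integral do rewrite IH.
rewrite integral_dual_step; last first.
  by move=> Y' _; rewrite lee_fin absorption_real_ge0.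
rewrite [absorption_real _ _]/= /averaged EFinM -sumEFin; congr (_ * _)%E.
apply: eq_bigr => b _; rewrite !EFinM diracE; congr (_ * ((_%:R)%:E * _))%E.
congr nat_of_bool; apply/idP/idP => [/set_mem/eqP//|/eqP bE]; exact/mem_set.
Qed.

Definition absorbed_by (t : nat) (Y : fsites d) : R :=
  \sum_(1 <= l < t.+1) absorption_real l Y.

(** First-step decomposition: the term [l = 1] is immediate absorption, the others continue from a
    nonempty set. The value 1 at the empty set is imposed because [absorbed_by 0] vanishes there. *)
Lemma absorbed_byS t Y : absorbed_by t.+1 Y =
  averaged (fun Y' => if Y' == fset0 then 1 else absorbed_by t Y') Y.
Proof.
rewrite (@eq_averaged _ (fun Y' => (Y' == fset0)%:R +
    (Y' != fset0)%:R * absorbed_by t Y')); last first.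
  by move=> Y'; case: eqVneq => _; rewrite ?mul0r ?addr0 ?add0r ?mul1r.
rewrite averagedD /absorbed_by big_nat_recl//; congr (_ + _).
rewrite /averaged; under [in RHS]eq_bigr do rewrite !mulr_sumr.
rewrite exchange_big/= mulr_sumr; apply: eq_big_nat => l /andP[l0 _].
(* Here [l] is positive; the recursion from [l] to [l.+1] does not start at [l = 0], since
   [absorption_real 1] is a base case. *)
by case: l l0.
Qed.

Section iterated_duality.
Variable F : nat -> fsites d -> R.
Hypothesis F01 : forall t Y, 0 <= F t Y <= 1.
Hypothesis F_fset0 : forall t, F t fset0 = 1.
Hypothesis FS : forall t, F t.+1 =1 averaged (F t).

(** Subtracting the two recursions leaves T applied to a nonnegative difference that vanishes at the
    empty set. Each step from a nonempty set gains a factor p(I_r). *)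
Lemma absorbed_by_error t Y :
  0 <= F t Y - absorbed_by t Y <= p (Ir d r) ^+ t.
Proof.
elim: t Y => [|t IH] Y.
  by rewrite /absorbed_by big_geq// subr0 expr0 F01.
have [->|Y0] := eqVneq Y fset0.
  rewrite absorbed_byS averaged_fset0 eqxx F_fset0 subrr lexx/=.
  exact: exprn_ge0.
rewrite FS absorbed_byS -averagedB.
set g := (fun Y' => _).
have gb Y' : 0 <= g Y' <= p (Ir d r) ^+ t.
  rewrite /g; case: eqVneq => [->|_]; last exact: IH.
  by rewrite F_fset0 subrr lexx exprn_ge0.
rewrite averaged_ge0/=; last by move=> Y'; case/andP: (gb Y').
rewrite exprS ler_pM ?dualD_ge0//.
- apply: sumr_ge0 => b _; rewrite mulr_ge0 ?dual_weight_ge0//.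
  by case/andP: (gb (branch b)).
(* Of the factors p(I_r) in [D Y], one is kept and the others are bounded by 1. *)
- have : (0 < #|` Y|)%N by rewrite cardfs_gt0.
  rewrite /D /dualD; case: #|` Y| => // n _.
  by rewrite exprS ler_piMr// exprn_ile1// ltW.
rewrite -[leRHS]mul1r -(sum_dual_weight pi_distr Y) mulr_suml.
apply: ler_sum => b _; rewrite ler_wpM2l ?dual_weight_ge0//.
by case/andP: (gb (branch b)).
Qed.

(** The partial sums increase, and the error bound keeps them below [F t Y], hence below 1. *)
Lemma cvg_absorbed_by Y : cvgn (absorbed_by ^~ Y).
Proof.
apply: nondecreasing_is_cvgn.
  apply/nondecreasing_seqP => t; rewrite /absorbed_by [leRHS]big_nat_recr//.
  by rewrite lerDl absorption_real_ge0.
exists 1 => _ [t _ <-]; have /andP[_] := F01 t Y; apply: le_trans.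
by rewrite -subr_ge0; case/andP: (absorbed_by_error t Y).
Qed.

(** A function of [p] and [pi] alone, hence a common limit for the families [F] of all initial
    laws. *)
Definition absorption_total (Y : fsites d) : R := limn (absorbed_by ^~ Y).

Lemma cvg_iterated_duality Y : F t Y @[t --> \oo] --> absorption_total Y.
Proof.
rewrite (_ : (F ^~ Y) = (fun t => absorbed_by t Y + (F t Y - absorbed_by t Y))).
  rewrite -[absorption_total Y]addr0; apply: cvgD; first exact: cvg_absorbed_by.
  apply: (@squeeze_cvgr _ _ _ _ (cst 0) (fun t => p (Ir d r) ^+ t)).
  - by near=> t; exact: absorbed_by_error.
  - exact: cvg_cst.
  - by apply: cvg_expr; rewrite ger0_norm.
by apply/funext => t; rewrite addrC subrK.
Unshelve. all: by end_near. Qed.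

Lemma absorption_series Y :
  (\sum_(1 <= l <oo) absorption D (dual_step pi_distr) l Y =
   (absorption_total Y)%:E)%E.
Proof.
(* After the shift, the partial sum over 1 <= l < n.+1 is [absorbed_by n]. *)
apply/cvg_lim => //; rewrite -cvg_shiftS/=.
rewrite (_ : (fun n => _) = EFin \o (absorbed_by ^~ Y)).
  by apply: cvg_EFin; [near=> n|exact: cvg_absorbed_by].
by apply/funext => n /=; rewrite -sumEFin; apply: eq_bigr => l _;
  rewrite absorptionE.
Unshelve. all: by end_near. Qed.

End iterated_duality.
End absorption_series.


(** * Weak convergence *)

(** For d >= 1 the constant vectors embed the naturals in the countable set of sites, which is
    therefore in bijection with them. *)
Lemma site_enumeration (d : nat) : (1 <= d)%N ->
  exists (e : nat -> site d) (e' : site d -> nat), cancel e e' /\ cancel e' e.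
Proof.
case: d => // d _.
have inf : infinite_set [set: site d.+1].
  apply/infiniteP; pose f (k : nat) : site d.+1 := const_mx k%:Z.
  have f_inj : {in [set: nat] &, injective f}.
    by move=> i j _ _ /matrixP /(_ ord0 ord0); rewrite !mxE => -[].
  apply: card_le_trans (subset_card_le (@subsetT _ (range f))).
  by move: (inj_card_eq f_inj); rewrite card_eq_le => /andP[].
have : ([set: site d.+1] #= [set: nat])%card.
  by apply: eq_card_nat => //; exact: countableP.
move=> /card_set_bijP[e']; rewrite setTT_bijective => -[e e'K eK].
by exists e, e'.
Qed.

Lemma cvg_sumr (R : realType) (I : Type) (s : seq I) (u : I -> nat -> R)
    (l : I -> R) : (forall i, u i t @[t --> \oo] --> l i) ->
  \sum_(i <- s) u i t @[t --> \oo] --> \sum_(i <- s) l i.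
Proof. by move=> ul; apply: cvg_big => //; exact: add_continuous. Qed.

Section finite_windows.
Context {R : realType} {d : nat}.
Variables (e : nat -> site d) (e' : site d -> nat).
Hypotheses (eK : cancel e e') (e'K : cancel e' e).

Definition agree (n : nat) (x y : site d -> bool) : Prop :=
  forall k, (k < n)%N -> x (e k) = y (e k).

(** Words carry the most recent letter first, hence [rev]; sites outside the window get the default
    [false]. *)
Definition extend (w : seq bool) : config d :=
  fun z => nth false (rev w) (e' z).

Lemma size_prefix_word x n : size (prefix_word e x n) = n.
Proof. by elim: n => //= n ->. Qed.

Lemma nth_prefix_word x n k : (k < n)%N ->
  nth false (rev (prefix_word e x n)) k = x (e k).
Proof.
elim: n => // n IH; rewrite ltnS leq_eqVlt /= rev_cons nth_rcons size_rev.
rewrite size_prefix_word => /orP[/eqP ->|kn]; first by rewrite ltnn eqxx.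
by rewrite kn IH.
Qed.

Lemma agree_extend x n : agree n x (extend (prefix_word e x n)).
Proof. by move=> k kn; rewrite /extend eK nth_prefix_word. Qed.

Definition window_set (w : seq bool) : set (config d) :=
  [set x | prefix_word e x (size w) = w].

Fixpoint window_constraints (w : seq bool) : seq (site d * bool) :=
  if w is b :: w' then (e (size w'), b) :: window_constraints w' else [::].

Lemma window_setE w : window_set w = constrained (window_constraints w).
Proof.
elim: w => [|b w IH]; first by apply/seteqP; split.
rewrite constrained_cons -IH; apply/seteqP; split => x /=.
  by rewrite /window_set/= => -[-> ->].
by rewrite /window_set/= => -[-> ->].
Qed.

Lemma measurable_window_set w : measurable (window_set w).
Proof. by rewrite window_setE; exact: measurable_constrained. Qed.

(** Exactly one word of length [n] has [x] in its window event. *)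
Lemma window_expansion n (G : seq bool -> R) (x : config d) :
  G (prefix_word e x n) = \sum_(w : n.-tuple bool) G w * \1_(window_set w) x.
Proof.
have sz : size (prefix_word e x n) == n by rewrite size_prefix_word.
rewrite (bigD1 (Tuple sz))//= big1 ?addr0 => [|w].
  by rewrite indicE mem_set ?mulr1// /window_set/= size_prefix_word.
move=> /eqP wx; rewrite indicE memNset ?mulr0//.
rewrite /window_set /= size_tuple => xw; apply: wx.
by apply: val_inj; rewrite /= xw.
Qed.

Lemma integral_window (P : probability (config d) R) n (G : seq bool -> R) :
  (\int[P]_x (G (prefix_word e x n))%:E =
   (\sum_(w : n.-tuple bool) G w * fine (P (window_set w)))%:E)%E.
Proof.
transitivity (\int[P]_x
    (\sum_(w : n.-tuple bool) (G w)%:E * (\1_(window_set w) x)%:E))%E.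
  by apply: eq_integral => x _; rewrite window_expansion -sumEFin.
have iw (w : n.-tuple bool) : P.-integrable setT (EFin \o \1_(window_set w)).
  apply: integrable_indic => //; exact: measurable_window_set.
rewrite integral_sum//; last first.
  by move=> w; apply: integrableZl => //; exact: iw.
rewrite -sumEFin; apply: eq_bigr => w _.
rewrite integralZl//; last exact: iw.
rewrite integral_indic ?setIT//; last exact: measurable_window_set.
by rewrite EFinM fineK// fin_num_measure//; exact: measurable_window_set.
Qed.

Lemma measurable_window n (G : seq bool -> R) :
  measurable_fun setT (fun x : config d => G (prefix_word e x n)).
Proof.
rewrite (_ : (fun x => _) =
  (fun x => \sum_(w : n.-tuple bool) G w * \1_(window_set w) x)).
  apply: measurable_sum => w; apply: measurable_funM => //.
  by apply: measurable_indic; exact: measurable_window_set.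
by apply/funext => x; exact: window_expansion.
Qed.

Lemma compact_ptws_bool : compact [set: {ptws site d -> bool}].
Proof.
have := @tychonoff _ (fun _ : site d => _) _ (fun=> bool_compact).
by congr (compact _); rewrite eqEsubset.
Qed.

Lemma near_agree (x : {ptws site d -> bool}) n :
  \forall y \near nbhs x, agree n x y.
Proof.
have coordx z : \forall y \near nbhs x, x z = y z.
  have := @proj_continuous _ (fun _ : site d => bool) z x.
  by move=> /discrete_cvg; apply: filterS => y yx; exact/esym/yx.
elim: n => [|n IH]; first by near=> y.
near=> y => k; rewrite ltnS leq_eqVlt => /orP[/eqP ->|]; first by near: y.
by move: k; near: y.
Unshelve. all: by end_near. Qed.

(** Agreement on windows gives a neighbourhood base at [x] for the product topology: [near_agree]
    and [agree_filter_cvg] are the two inclusions. *)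
Definition agree_filter (x : site d -> bool) :
    set_system {ptws site d -> bool} :=
  [set A | exists n, forall y, agree n x y -> A y].

Lemma agreeW m n x y : (m <= n)%N -> agree n x y -> agree m x y.
Proof. by move=> mn xy k km; apply: xy; exact: leq_trans mn. Qed.

Lemma agree_filter_filter x : Filter (agree_filter x).
Proof.
split.
- by exists 0%N.
- move=> A B [m Am] [n Bn]; exists (maxn m n) => y xy; split.
    by apply: Am; apply: agreeW xy; exact: leq_maxl.
  by apply: Bn; apply: agreeW xy; exact: leq_maxr.
- by move=> A B AB [n An]; exists n => y /An; exact: AB.
Qed.

Lemma agree_filter_cvg x : agree_filter x --> (x : {ptws site d -> bool}).
Proof.
apply/(@pointwise_cvgP (discrete_topology (site d)) bool).
  exact: agree_filter_filter.
move=> z A Az; exists (e' z).+1 => y xy /=.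
have := xy (e' z) (ltnSn _); rewrite e'K => <-.
exact: nbhs_singleton.
Qed.

Lemma uniform_window (f : {ptws site d -> bool} -> R) : continuous f ->
  forall eps, 0 < eps ->
  exists n, forall x y, agree n x y -> `|f x - f y| < eps.
Proof.
move=> cf eps eps0.
have : \forall n \near \oo, forall x, [set: {ptws site d -> bool}] x ->
    forall y, agree n x y -> `|f x - f y| < eps.
  apply: (@compact_near_coveringP _ _).1 compact_ptws_bool _ _ _ _ _ => x _.
  have /cvgrPdist_lt/(_ (eps / 2)) := cf x.
  rewrite divr_gt0// => /(_ isT)/agree_filter_cvg[n fn].
  (* If [y] agrees with [x] on [n] sites and [z] with [y] on at least [n], both agree with [x]
     there, so [f y] and [f z] are within [eps / 2] of [f x]. *)
  exists (agree n x, [set m | (n <= m)%N]) => /=.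
    by split; [exact: near_agree|exists n].
  move=> [y m] [/= xy nm] z yz.
  have xz : agree n x z.
    by move=> k kn; rewrite xy//; apply: yz; exact: leq_trans nm.
  rewrite (_ : f y - f z = (f x - f z) - (f x - f y)); last by ring.
  by rewrite (splitr eps) (le_lt_trans (ler_normB _ _))// ltrD//; exact: fn.
by move=> [n _ /(_ n (leqnn n)) fn]; exists n => x y; exact: fn.
Qed.

Lemma integral_le_dist (P : probability (config d) R) (g h : config d -> R)
    eps :
  P.-integrable setT (EFin \o g) -> P.-integrable setT (EFin \o h) ->
  (forall x, `|g x - h x| <= eps) ->
  `|fine (\int[P]_x (g x)%:E)%E - fine (\int[P]_x (h x)%:E)%E| <= eps.
Proof.
move=> ig ih gh; rewrite -(RintegralB measurableT ig ih).
have igh : P.-integrable setT (EFin \o (fun x => g x - h x)).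
  exact: (integrableB measurableT ig ih).
apply: (le_trans (le_normr_Rintegral measurableT igh)).
rewrite [leRHS](_ : _ = (\int[P]_x cst eps x)%R).
  apply: le_Rintegral => //; first exact: (integrable_norm igh).
  exact: finite_measure_integrable_cst.
rewrite Rintegral_cst//; have PT := congr1 fine (probability_setT P).
by rewrite [X in _ * X]PT mulr1.
Qed.

Lemma weak_cvg_window (P_ : nat -> probability (config d) R)
    (mu : probability (config d) R) :
  (forall w,
    fine (P_ t (window_set w)) @[t --> \oo] --> fine (mu (window_set w))) ->
  weak_cvg P_ mu.
Proof.
move=> Pmu f cf [M fM].
(* Being a pointwise limit of window functions, [f] is measurable for the cylinder sigma-algebra. *)
have agree_cvg (x : config d) :
    f (extend (prefix_word e x n)) @[n --> \oo] --> f x.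
  apply/cvgrPdist_lt => eps eps0; have [n fn] := uniform_window cf eps0.
  near=> m; apply: fn; apply: (@agreeW _ m); last exact: agree_extend.
  by near: m; exists n.
have mf : measurable_fun setT (f : config d -> R).
  apply: (@measurable_fun_cvg _ _ _ _
    (fun n (x : config d) => f (extend (prefix_word e x n)))) => // n.
  exact: (measurable_window n (f \o extend)).
have bounded_integrable (P : probability (config d) R) (g : config d -> R) :
    measurable_fun setT g -> (forall x, `|g x| <= M) ->
    P.-integrable setT (EFin \o g).
  move=> mg gM; apply: (@le_integrable _ _ _ _ _ _ _ (cst M%:E)) => //.
  - exact/measurable_EFinP.
  - move=> x _ /=; rewrite lee_fin (le_trans (gM x))//.
    by rewrite ger0_norm// (le_trans _ (gM x)).
  - exact: finite_measure_integrable_cst.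
have fint (P : probability (config d) R) := bounded_integrable P f mf fM.
have wint (P : probability (config d) R) n : P.-integrable setT
    (EFin \o (fun x : config d => f (extend (prefix_word e x n)))).
  exact: (bounded_integrable P (fun x => f (extend (prefix_word e x n)))
    (measurable_window n (f \o extend)) (fun x => fM _)).
have EfE (P : probability (config d) R) :
    (\int[P]_x (f x)%:E = (fine (\int[P]_x (f x)%:E))%:E)%E.
  by rewrite fineK//; exact: (integrable_fin_num measurableT (fint P)).
rewrite EfE; under eq_fun do rewrite EfE.
apply: cvg_EFin; first by near=> t; rewrite EfE.
apply/cvgrPdist_le => eps eps0.
have eps3 : 0 < eps / 3 by rewrite divr_gt0.
have [n fn] := uniform_window cf eps3.
have close (x : config d) : `|f x - f (extend (prefix_word e x n))| <= eps / 3.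
  by apply/ltW/fn/agree_extend.
have win (P : probability (config d) R) := integral_window P n (f \o extend).
pose I (P : probability (config d) R) :=
  \sum_(w : n.-tuple bool) f (extend w) * fine (P (window_set w)).
have cvgI : I (P_ t) @[t --> \oo] --> I mu.
  apply: cvg_sumr => w; apply: cvgM; first exact: cvg_cst.
  exact: Pmu.
have fI (P : probability (config d) R) :
    `|fine (\int[P]_x (f x)%:E)%E - I P| <= eps / 3.
  have := integral_le_dist (fint P) (wint P n) close.
  by rewrite win.
near=> t.
have It : `|I mu - I (P_ t)| <= eps / 3.
  by near: t; move/cvgrPdist_le : cvgI; apply.
rewrite /=.
(* Replacing [f] by its window function costs [eps / 3] under each of [mu] and [P_ t]; the third
   share is the convergence of the finite sums [I]. *)
rewrite (_ : _ - _ = (fine (\int[mu]_x (f x)%:E)%E - I mu) +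
  (I mu - I (P_ t)) - (fine (\int[P_ t]_x (f x)%:E)%E - I (P_ t)));
  last by ring.
rewrite (le_trans (ler_normB _ _))//.
rewrite (_ : eps = eps / 3 + eps / 3 + eps / 3); last by field.
by rewrite lerD// (le_trans (ler_normD _ _))// lerD.
Unshelve. all: by end_near. Qed.

End finite_windows.


(** * The limit law *)

Section limit_law.
Context {R : realType} {d r : nat}.
Variables (p lam pi : {set offset d r} -> R).
Hypothesis p_lam : class_C_map p lam.
Hypothesis pi_distr : is_distribution pi.
Hypothesis lam_pi : forall J, lam J = p (Ir d r) * pi J.
Hypothesis p_ge0 : 0 <= p (Ir d r).
Hypothesis p_lt1 : p (Ir d r) < 1.
Variable k : R.-pker config d ~> config d.
Hypothesis k_pca : is_PCA p k.
Implicit Types P : probability (config d) R.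

Local Notation h := (absorption_total p pi).

Lemma all_ones01 P (Y : fsites d) : 0 <= all_ones P Y <= 1.
Proof.
rewrite -!lee_fin -all_onesE measure_ge0 probability_le1//.
exact: measurable_cylinder_on.
Qed.

Lemma all_ones_fset0 P : all_ones P fset0 = 1.
Proof. by rewrite /all_ones ones0 probability_setT. Qed.

Lemma all_ones_next P : all_ones (next_law k P) =1 averaged p pi (all_ones P).
Proof. by move=> Y; apply: (all_ones_next_law p_lam pi_distr lam_pi). Qed.

Lemma all_ones_lawS P t :
  all_ones (law k P t.+1) =1 averaged p pi (all_ones (law k P t)).
Proof. exact: all_ones_next. Qed.

Lemma cvg_all_ones P Y : all_ones (law k P t) Y @[t --> \oo] --> h Y.
Proof.
apply: (@cvg_iterated_duality _ _ _ _ _ pi_distr p_ge0 p_lt1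
  (fun t => all_ones (law k P t))) => t.
- exact: all_ones01.
- exact: all_ones_fset0.
- exact: all_ones_lawS.
Qed.

Lemma absorption_series_total Y :
  (\sum_(1 <= l <oo) absorption (dualD p) (dual_step pi_distr) l Y =
   (h Y)%:E)%E.
Proof.
(* Any initial law would do: it supplies a family [F] that satisfies the hypotheses of the series
   lemma. *)
pose P : probability (config d) R := \d_((fun=> false) : config d).
apply: (@absorption_series _ _ _ _ _ pi_distr p_ge0 p_lt1
  (fun t => all_ones (law k P t))) => t.
- exact: all_ones01.
- exact: all_ones_fset0.
- exact: all_ones_lawS.
Qed.

(** Pass to the limit in the recursion for [all_ones] along one initial law. *)
Lemma averaged_absorption_total : averaged p pi h =1 h.
Proof.
move=> Y; pose P : probability (config d) R := \d_((fun=> false) : config d).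
have := @cvg_all_ones P Y; rewrite -cvg_shiftS => /cvg_lim <- //.
apply/esym/cvg_lim => //.
rewrite (_ : (fun n => _) = (fun t => averaged p pi (all_ones (law k P t)) Y)).
  apply: cvgM; first exact: cvg_cst.
  apply: cvg_sumr => b; apply: cvgM; first exact: cvg_cst.
  exact: cvg_all_ones.
by apply/funext => t; exact: all_ones_lawS.
Qed.

Lemma invariant_all_ones P : invariant_law k P -> all_ones P =1 h.
Proof.
move=> Pinv Y; have := @cvg_all_ones P Y.
rewrite (_ : (fun t => _) = cst (all_ones P Y)).
  by move=> /cvg_lim <- //; rewrite lim_cst.
apply/funext => t /=; elim: t Y => // t IH Y.
(* Invariance is equality on measurable sets only, so the induction compares values of [all_ones]
   instead of laws. *)
rewrite all_ones_lawS (eq_averaged _ _ IH) -all_ones_next.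
rewrite /all_ones; congr fine; apply: Pinv; exact: measurable_cylinder_on.
Qed.

(** The inclusion-exclusion coefficients and [h] do not depend on [P], so neither does the limit. *)
Lemma cvg_constrained s : exists l : R, forall P,
  fine (law k P t (constrained s)) @[t --> \oo] --> l.
Proof.
have [K [alpha [Z KE]]] := @constrained_expansion R d s fset0.
exists (\sum_i (alpha i)%:~R * h (Z i)) => P.
rewrite (_ : (fun t => _) =
    (fun t => \sum_i (alpha i)%:~R * all_ones (law k P t) (Z i))).
  apply: cvg_sumr => j; apply: cvgM; first exact: cvg_cst.
  exact: cvg_all_ones.
by apply/funext => t; move: (KE (law k P t)); rewrite ones0 setTI => ->.
Qed.

Lemma limit_law_exists : (1 <= d)%N -> exists mu : probability (config d) R,
  (forall P, weak_cvg (law k P) mu) /\ all_ones mu =1 h.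
Proof.
move=> /site_enumeration[e [e' [eK e'K]]].
have /choice[l lP] := cvg_constrained.
(* The limiting window probabilities become the interval lengths of the splitting construction,
   whose hypotheses are checked next. *)
pose m (w : seq bool) := l (window_constraints e w).
have mP P w : fine (law k P t (window_set e w)) @[t --> \oo] --> m w.
  by rewrite window_setE; exact: lP.
pose P0 : probability (config d) R := \d_((fun=> false) : config d).
have fin P w : P (window_set e w) \is a fin_num.
  by rewrite fin_num_measure//; exact: measurable_window_set.
have m_lim w : m w = limn (fun t => fine (law k P0 t (window_set e w))).
  by apply/esym/cvg_lim => //; exact: mP.
have m_ge0 w : 0 <= m w.
  rewrite m_lim; apply: limr_ge; first by apply/cvg_ex; exists (m w); exact: mP.
  by apply: nearW => t; rewrite fine_ge0.
have window_nil : window_set e [::] = setT by apply/seteqP; split.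
have m_nil : m [::] = 1.
  rewrite m_lim (_ : (fun t => _) = cst 1) ?lim_cst//.
  by apply/funext => t; rewrite window_nil probability_setT.
have m_split w : m w = m (false :: w) + m (true :: w).
  rewrite m_lim; apply/cvg_lim => //.
  rewrite (_ : (fun t => _) =
    (fun t => fine (law k P0 t (window_set e (false :: w))) +
      fine (law k P0 t (window_set e (true :: w))))).
    by apply: cvgD; exact: mP.
  apply/funext => t; rewrite -fineD// -measureU; last 3 first.
  - exact: measurable_window_set.
  - exact: measurable_window_set.
  - by apply/seteqP; split => x //=; rewrite /window_set/= => -[[-> _] []].
  congr (fine (_ _)); apply/seteqP; split => x; rewrite /window_set/=.
    by move=> ->; case: (x _); [right|left].
  by case=> -[_ ->].
have [mu muE] := bits_law_exists eK m_ge0 m_nil m_split.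
have muw P w : fine (law k P t (window_set e w)) @[t --> \oo] -->
    fine (mu (window_set e w)).
  by rewrite /window_set muE; exact: mP.
exists mu; split; first by move=> P; exact: (weak_cvg_window eK e'K (muw P)).
move=> Y.
have [n Yn] : exists n, forall z, z \in Y -> (e' z < n)%N.
  exists (\max_(z <- Y) e' z).+1 => z zY; rewrite ltnS.
  exact: (@leq_bigmax_seq _ _ _ e').
(* Once the window contains [Y], its word tells whether a configuration is 1 on [Y]. *)
have onesW P : all_ones P Y = \sum_(w : n.-tuple bool)
    dualH (extend e' w) Y * fine (P (window_set e w)).
  apply: EFin_inj.
  rewrite -(integral_window e P n (fun w => dualH (extend e' w) Y)).
  rewrite -all_onesE -integral_dualH; apply: eq_integral => x _.
  congr EFin; rewrite /dualH; congr (_%:R); congr nat_of_bool.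
  apply: eq_forallb => z.
  by have := agree_extend eK x (Yn _ (valP z)); rewrite e'K.
have := @cvg_all_ones P0 Y => /cvg_lim <- //; apply/esym/cvg_lim => //.
under eq_fun do rewrite onesW.
rewrite onesW; apply: cvg_sumr => w; apply: cvgM; first exact: cvg_cst.
exact: muw.
Qed.

Lemma limit_law_invariant mu : all_ones mu =1 h -> invariant_law k mu.
Proof.
move=> muh; apply: eq_probability => Y.
by rewrite all_ones_next (eq_averaged _ _ muh) muh averaged_absorption_total.
Qed.

End limit_law.

(** * The branching distribution, and the assembly of the results *)

Lemma class_C_dual_distribution (R : realType) (d r : nat)
    (p lam : {set offset d r} -> R) : class_C_map p lam ->
  exists pi : {set offset d r} -> R,
    is_distribution pi /\ forall J, lam J = p (Ir d r) * pi J.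
Proof.
move=> [lam01 pE].
have sum_lam : \sum_J lam J = p (Ir d r).
  by rewrite pE; apply: eq_bigl => J; rewrite finset.subsetT.
have lam0 J : 0 <= lam J by case/andP: (lam01 J).
(* If p(I_r) = 0, the nonnegative [lam] sums to 0 and vanishes, so any distribution fits; the point
   mass at the empty set is taken. *)
have [q0|q0] := eqVneq (p (Ir d r)) 0.
  exists (fun J => (J == finset.set0)%:R); split; first split=> //.
    rewrite (bigD1 finset.set0)//= eqxx big1 ?addr0// => J /negbTE ->.
    by [].
  move=> J; rewrite q0 mul0r; apply/eqP.
  by rewrite eq_le lam0 andbT -q0 -sum_lam (bigD1 J)//= lerDl sumr_ge0.
exists (fun J => lam J / p (Ir d r)); split; last first.
  by move=> J; rewrite mulrCA divff// mulr1.
split=> [J|]; last by rewrite -mulr_suml sum_lam divff.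
by rewrite divr_ge0// -sum_lam sumr_ge0.
Qed.

Local Open Scope ereal_scope.

Theorem theorem2 (R : realType) (d r : nat) (d_ge1 : (1 <= d)%N)
    (r_ge1 : (1 <= r)%N) (p : {set offset d r} -> R)
    (p01 : forall J, (0 <= p J <= 1)%R)
    (eta : R.-pker config d ~> config d) (eta_pca : is_PCA p eta)
    (pC : class_C p) (p_lt1 : (p (Ir d r) < 1)%R) :
  ergodic eta /\
  exists (lam pi : {set offset d r} -> R) (xi : R.-pker fsites d ~> fsites d),
    [/\ class_C_map p lam,
        is_distribution pi,
        forall J, lam J = (p (Ir d r) * pi J)%R &
        is_dual_process pi xi] /\
    (forall (x : config d) (Y : fsites d),
       \int[eta x]_y (dualH y Y : R)%:E =
       (dualD p Y)%:E * \int[xi Y]_Y' (dualH x Y' : R)%:E) /\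
    (forall mu : probability (config d) R, invariant_law eta mu ->
     forall U : set (config d), cylinders U ->
     exists (K : finType) (alpha : K -> int) (Y : K -> fsites d),
       mu U = \sum_(k : K) ((alpha k)%:~R : R)%:E *
                \sum_(1 <= l <oo) absorption (dualD p) xi l (Y k)).
Proof.
have [lam p_lam] := pC.
have [pi [pi_distr lam_pi]] := class_C_dual_distribution p_lam.
have p_ge0 : (0 <= p (Ir d r))%R by case/andP: (p01 (Ir d r)).
have inv_h := invariant_all_ones p_lam pi_distr lam_pi p_ge0 p_lt1 eta_pca.
split.
  have [mu [eta_mu muh]] :=
    limit_law_exists p_lam pi_distr lam_pi p_ge0 p_lt1 eta_pca d_ge1.
  exists mu; split => //.
    exact: (limit_law_invariant p_lam pi_distr lam_pi p_ge0 p_lt1 eta_pca muh).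
  move=> nu nu_inv; apply: eq_probability => Y.
  by rewrite muh (inv_h _ nu_inv).
exists lam, pi, (dual_step pi_distr); split; [|split].
- by split => // Y A; rewrite dual_stepE.
- exact: (pca_duality p_lam pi_distr lam_pi eta_pca).
move=> mu mu_inv U [L [phi ->]].
(* Expanding from the empty set of ones leaves the cylinder itself, as [ones fset0] is the whole
   space. *)
have [K [alpha [Z KE]]] :=
  @constrained_expansion R d [seq (z, phi z) | z <- L] fset0.
exists K, alpha, Z; move: (KE mu); rewrite ones0 setTI -cylinder_onE => ->.
rewrite -sumEFin; apply: eq_bigr => i _.
rewrite (absorption_series_total p_lam pi_distr lam_pi p_ge0 p_lt1 eta_pca).
by rewrite EFinM (inv_h _ mu_inv).
Qed.
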